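(* Let $\vec r(t)$, $t_0<t<t_1$, be a simple space curve of class $C^3$ in $\mathbb{R}^3$ with $(\vec r'(t)\wedge\vec r''(t))\cdot\vec r'''(t)\neq0$ for all $t\in(t_0,t_1)$, and consider the following expressions on $(t_0,t_1)$: $$E_1(t)=|\vec r'(t)|,\qquad E_2(t)=\frac{|-(\vec r'(t)\cdot\vec r''(t))\vec r'(t)+\vec r'^2(t)\,\vec r''(t)|}{2|\vec r'(t)|^3},\qquad E_3(t)=0,$$ $$E_4(t)=\frac{|-(\vec r''(t)\cdot\vec r'''(t))\vec r''(t)+\vec r''^2(t)\,\vec r'''(t)|}{3|\vec r''(t)|^3},\qquad E_5(t)=\frac{(\vec r'(t)\wedge\vec r''(t))\cdot\vec r'''(t)}{|(\vec r'(t)\wedge\vec r''(t))\cdot\vec r'''(t)|}.$$ If $\vec r_1(t)$, $t_0<t<t_1$, is a simple space curve of class $C^3$ with $(\vec r_1'\wedge\vec r_1'')\cdot\vec r_1'''\neq0$ on $(t_0,t_1)$ whose $\phi(t)$, $|\vec\psi_{12}(t)|$, $|\vec\psi_{13}(t)|$, $|\vec\psi_{23}(t)|$ and $\epsilon(t)$ are given by $E_1(t)$, $E_2(t)$, $E_3(t)$, $E_4(t)$ and $E_5(t)$ respectively, then $\vec r_1(t)$ and $\vec r(t)$ coincide on $(t_0,t_1)$ up to position in space; that is, there is a rigid motion (orientation-preserving isometry) $T$ of $\mathbb{R}^3$ with $\vec r_1(t)=T(\vec r(t))$ for all $t\in(t_0,t_1)$.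
   Context: $\wedge$ and $\cdot$ are cross and dot product; $\vec w^2=\vec w\cdot\vec w$. For a $C^3$ curve $\vec c(t)$ in $\mathbb{R}^3$ with $(\vec c'\wedge\vec c'')\cdot\vec c'''\neq0$: - $\phi(t)=|\vec c'(t)|$ (local first derivative). - For fixed $t$ and small $\Delta t>0$ write $\vec c(t+\Delta t)-\vec c(t)=g_1(\Delta t)\vec c'(t)+g_2(\Delta t)\vec c''(t)+g_3(\Delta t)\vec c'''(t)$, and set $\vec w_{12}=g_1\vec c'+g_2\vec c''$, $\vec w_{13}=g_1\vec c'+g_3\vec c'''$, $\vec w_{23}=g_2\vec c''+g_3\vec c'''$ (nonzero for small $\Delta t>0$). With $\vec e_{ij}=\vec w_{ij}/|\vec w_{ij}|$ and $\vec e_{ij}(0)=\lim_{\Delta t\to0^+}\vec e_{ij}(\Delta t)$, the local projective rotational velocity functions are $\vec\psi_{ij}(t)=\lim_{\Delta t\to0^+}\frac{\vec e_{ij}(\Delta t)-\vec e_{ij}(0)}{\Delta t}$. Explicitly, $\vec\psi_{12}=\frac{-(\vec c'\cdot\vec c'')\vec c'+\vec c'^2\vec c''}{2|\vec c'|^3}$, $\vec\psi_{13}=\vec 0$, $\vec\psi_{23}=\frac{-(\vec c''\cdot\vec c''')\vec c''+\vec c''^2\vec c'''}{3|\vec c''|^3}$. - $\epsilon(t)=\frac{(\vec c'(t)\wedge\vec c''(t))\cdot\vec c'''(t)}{|(\vec c'(t)\wedge\vec c''(t))\cdot\vec c'''(t)|}$ (sign function). *)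

(* Defs.v *)
From HB Require Import structures.
From mathcomp Require Import all_boot all_order all_algebra.
From mathcomp Require Import all_classical all_reals all_analysis.
Set Implicit Arguments.
Unset Strict Implicit.
Unset Printing Implicit Defensive.
Import Order.TTheory GRing.Theory Num.Theory.
Import numFieldNormedType.Exports.
Local Open Scope classical_set_scope.
Local Open Scope ring_scope.

Section Vectors.
Variable R : realType.
Implicit Types (u v w : 'rV[R]_3) (T : 'rV[R]_3 -> 'rV[R]_3).

Definition dot u v : R := \sum_i u 0 i * v 0 i.

(* The library norm `|u| on row vectors is the sup norm, hence this one. *)
Definition enorm u : R := Num.sqrt (dot u u).

(* Indices are added modulo 3 in 'I_3. *)
Definition cross u v : 'rV[R]_3 :=
  \row_(k < 3) (u 0 (k + 1) * v 0 (k + 2%:R) - u 0 (k + 2%:R) * v 0 (k + 1)).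

Definition triple u v w : R := dot (cross u v) w.

Definition euclidean_isometry T := forall p q, enorm (T p - T q) = enorm (p - q).

(* T sends positively oriented frames, attached at any point p, to
   positively oriented frames. *)
Definition orientation_preserving T := forall p u v w, 0 < triple u v w ->
  0 < triple (T (p + u) - T p) (T (p + v) - T p) (T (p + w) - T p).

Definition rigid_motion T := euclidean_isometry T /\ orientation_preserving T.

End Vectors.

Section Curves.
Variable R : realType.
Implicit Types (c : R -> 'rV[R]_3) (t h : R) (i j : 'I_3).

Definition class_C3 c (t0 t1 : R) := forall t, t0 < t < t1 ->
  [/\ derivable c t 1, derivable (derive1n 1 c) t 1,
      derivable (derive1n 2 c) t 1 & {for t, continuous (derive1n 3 c)}].

Definition simple_curve c (t0 t1 : R) := forall s t,
  t0 < s < t1 -> t0 < t < t1 -> c s = c t -> s = t.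

Definition nondegenerate_curve c (t0 t1 : R) := forall t, t0 < t < t1 ->
  triple (derive1n 1 c t) (derive1n 2 c t) (derive1n 3 c t) != 0.

Definition phi c t : R := enorm (derive1n 1 c t).

(* The frame at t has rows c'(t), c''(t), c'''(t); row i is the derivative
   of order i + 1. *)
Definition curve_frame c t : 'M[R]_3 := \matrix_(i < 3) derive1n i.+1 c t.

(* The coordinates (g_1, g_2, g_3) of c(t + h) - c(t) in the frame at t. *)
Definition gcoord c t h : 'rV[R]_3 := (c (t + h) - c t) *m invmx (curve_frame c t).

Definition wvec c i j t h : 'rV[R]_3 :=
  gcoord c t h 0 i *: derive1n i.+1 c t + gcoord c t h 0 j *: derive1n j.+1 c t.

Definition evec c i j t h : 'rV[R]_3 :=
  (enorm (wvec c i j t h))^-1 *: wvec c i j t h.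

(* lim is total, but for a C^3 curve with nonzero triple product at t both
   limits below exist: the coordinates of c(t + h) - c(t) are h + o(h^3),
   h^2 / 2 + o(h^3) and h^3 / 6 + o(h^3). *)
Definition evec0 c i j t : 'rV[R]_3 := lim (evec c i j t h @[h --> 0^'+]).

Definition psi c i j t : 'rV[R]_3 :=
  lim (h^-1 *: (evec c i j t h - evec0 c i j t) @[h --> 0^'+]).

Definition psi12 c t := psi c 0 1 t.
Definition psi13 c t := psi c 0 2%:R t.
Definition psi23 c t := psi c 1 2%:R t.

Definition epsilon c t : R :=
  triple (derive1n 1 c t) (derive1n 2 c t) (derive1n 3 c t) /
  `|triple (derive1n 1 c t) (derive1n 2 c t) (derive1n 3 c t)|.

End Curves.

(* Main.v *)
(** Let [a, b, d] be the first three derivatives of a curve.  Up to [o(h^3)]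
    the coordinates of [c (t + h) - c t] in this frame are [h], [h^2 / 2] and
    [h^3 / 6], so that normalising [g_i c^(i) + g_j c^(j)] gives
    [|psi12| = |b - proj_a b| / (2 |a|)] and
    [|psi23| = |d - proj_b d| / (3 |b|)].
    Hence [phi] determines [a.a], and then [a.b] by differentiation; [psi12]
    then yields [b.b], so [a.d] and [b.d] by differentiation; [psi23] yields
    [d.d].  The whole Gram matrix of [(a, b, d)] is thus known, and with it
    the square of the determinant, whose sign is [epsilon].

    Now let [M] have rows [a, b, a x b].  It is differentiable for a [C^3]
    curve, unlike the frame [(a, b, d)] itself, and the rows of [M'] are
    [b, d, a x d].  For two curves with the same data, [Q = M^-1 M1] is a
    rotation and satisfies [M' Q = M1'], so [Q' = M^-1 (M1' - M' Q) = 0].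
    Hence [Q] is a constant rotation, and [r1 - r Q] is a constant vector. *)

Require Import Defs.
From mathcomp Require Import all_boot all_order all_algebra.
From mathcomp Require Import all_classical all_reals all_analysis.
From mathcomp Require Import ring lra.
Import Order.TTheory GRing.Theory Num.Theory.
Import numFieldNormedType.Exports.
Local Open Scope classical_set_scope.
Local Open Scope ring_scope.
Set Implicit Arguments.
Unset Strict Implicit.
Unset Printing Implicit Defensive.

(** * Dot, cross and triple products in coordinates, with their Gram identities *)

Section VectorAlgebra.
Variable R : realType.
Implicit Types (u v w : 'rV[R]_3) (a : R).

(** Indices are kept as ring numerals of ['I_3], the form in which [cross] adds them. *)
Lemma ord3P (P : 'I_3 -> Prop) : P 0 -> P 1 -> P 2%:R -> forall i, P i.
Proof.
move=> P0 P1 P2 [[|[|[|//]]] lti].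
- by rewrite (_ : Ordinal lti = 0) //; apply: val_inj.
- by rewrite (_ : Ordinal lti = 1) //; apply: val_inj.
- by rewrite (_ : Ordinal lti = 2%:R) //; apply: val_inj.
Qed.

Lemma big_ord3 (f : 'I_3 -> R) : \sum_i f i = f 0 + f 1 + f 2%:R.
Proof.
rewrite !big_ord_recl big_ord0 addr0 addrA.
by congr (f _ + f _ + f _); apply: val_inj.
Qed.

Lemma dotE u v : dot u v = u 0 0 * v 0 0 + u 0 1 * v 0 1 + u 0 2%:R * v 0 2%:R.
Proof. exact: big_ord3. Qed.

Lemma cross0E u v : cross u v 0 0 = u 0 1 * v 0 2%:R - u 0 2%:R * v 0 1.
Proof. by rewrite mxE !add0r. Qed.

Lemma cross1E u v : cross u v 0 1 = u 0 2%:R * v 0 0 - u 0 0 * v 0 2%:R.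
Proof. by rewrite mxE; congr (u 0 _ * v 0 _ - u 0 _ * v 0 _); apply/eqP. Qed.

Lemma cross2E u v : cross u v 0 2%:R = u 0 0 * v 0 1 - u 0 1 * v 0 0.
Proof. by rewrite mxE; congr (u 0 _ * v 0 _ - u 0 _ * v 0 _); apply/eqP. Qed.

Definition crossE := (cross0E, cross1E, cross2E).

Lemma dotC u v : dot u v = dot v u.
Proof. by rewrite !dotE; ring. Qed.

Lemma dotDl u v w : dot (u + v) w = dot u w + dot v w.
Proof. by rewrite !dotE !mxE; ring. Qed.

Lemma dotDr u v w : dot u (v + w) = dot u v + dot u w.
Proof. by rewrite !dotE !mxE; ring. Qed.

Lemma dotZl a u v : dot (a *: u) v = a * dot u v.
Proof. by rewrite !dotE !mxE; ring. Qed.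

Lemma dotZr a u v : dot u (a *: v) = a * dot u v.
Proof. by rewrite !dotE !mxE; ring. Qed.

Lemma dot_ge0 u : 0 <= dot u u.
Proof. by apply: sumr_ge0 => i _; rewrite -expr2 sqr_ge0. Qed.

Lemma dot_eq0 u : (dot u u == 0) = (u == 0).
Proof.
apply/eqP/eqP => [u0|->]; last by rewrite dotE !mxE; ring.
apply/rowP => i; rewrite mxE; apply/eqP; rewrite -sqrf_eq0 expr2; apply/eqP.
by apply: (psumr_eq0P _ u0) => // j _; rewrite -expr2 sqr_ge0.
Qed.

Lemma dot_gt0 u : (0 < dot u u) = (u != 0).
Proof. by rewrite lt0r dot_ge0 andbT dot_eq0. Qed.

Lemma sqr_enorm u : enorm u ^+ 2 = dot u u.
Proof. by rewrite sqr_sqrtr ?dot_ge0. Qed.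

Lemma enorm_gt0 u : (0 < enorm u) = (u != 0).
Proof. by rewrite sqrtr_gt0 dot_gt0. Qed.

Lemma eq_enorm u v : (enorm u = enorm v) <-> (dot u u = dot v v).
Proof. by split=> [uv|uv]; [rewrite -!sqr_enorm uv | rewrite /enorm uv]. Qed.

Lemma enormZ a u : enorm (a *: u) = `|a| * enorm u.
Proof.
by rewrite /enorm dotZl dotZr mulrA -expr2 sqrtrM ?sqr_ge0 // sqrtr_sqr.
Qed.

(* Scaled by [|u|^2], the component of [v] orthogonal to [u]. *)
Definition reject u v := - (dot u v *: u) + dot u u *: v.

(** The bracket is the Gram determinant of [u] and [v]. For known [dot u u != 0] and [dot u v], this
    squared norm therefore determines [dot v v]. *)
Lemma dot_reject u v :
  dot (reject u v) (reject u v) = dot u u * (dot u u * dot v v - dot u v ^+ 2).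
Proof.
by rewrite /reject -scaleNr !(dotDl, dotDr, dotZl, dotZr) (dotC v u); ring.
Qed.

(** The Binet-Cauchy identity. *)
Lemma dot_cross u v w x :
  dot (cross u v) (cross w x) = dot u w * dot v x - dot u x * dot v w.
Proof. by rewrite !dotE !crossE; ring. Qed.

Lemma crossvv u : cross u u = 0.
Proof. by apply/rowP; apply: ord3P; rewrite crossE !mxE; ring. Qed.

Lemma dot0v u : dot 0 u = 0.
Proof. by rewrite dotE !mxE; ring. Qed.

Lemma tripleC u v w : triple v w u = triple u v w.
Proof. by rewrite /triple !dotE !crossE; ring. Qed.

(** The square of a determinant is the Gram determinant, expanded here along its first row. *)
Lemma sqr_triple u v w : triple u v w ^+ 2 =
  dot u u * (dot v v * dot w w - dot v w ^+ 2)
  - dot u v * (dot u v * dot w w - dot v w * dot u w)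
  + dot u w * (dot u v * dot v w - dot v v * dot u w).
Proof. by rewrite /triple !dotE !crossE; ring. Qed.

Definition rows3 u v w : 'M[R]_3 := \matrix_(i < 3) [:: u; v; w]`_i.

Lemma row_rows3 u v w (i : 'I_3) : row i (rows3 u v w) = [:: u; v; w]`_i.
Proof. by rewrite rowK. Qed.

Lemma rows3M u v w (A : 'M[R]_3) :
  rows3 u v w *m A = rows3 (u *m A) (v *m A) (w *m A).
Proof. by apply/row_matrixP; apply: ord3P; rewrite row_mul !row_rows3. Qed.

Lemma rows3_gram u v w x y z : rows3 u v w *m (rows3 x y z)^T =
  \matrix_(i, j) dot ([:: u; v; w]`_i) ([:: x; y; z]`_j).
Proof.
by apply/matrixP => i j; rewrite !mxE; apply: eq_bigr => k _; rewrite !mxE.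
Qed.

Lemma det_rows3 u v w : \det (rows3 u v w) = triple u v w.
Proof.
(* Indexing the entries by natural numbers lets the indices produced by cofactor expansion compute
   to numerals, so that [ring] recognises equal entries. *)
have [f uvwE] : exists f : nat -> nat -> R,
    forall i (k : 'I_3), [:: u; v; w]`_i 0 k = f i k.
  exists (fun i k => [:: u; v; w]`_i 0 (inord k)) => i k.
  by rewrite inord_val.
have [uE vE wE] : [/\ forall k : 'I_3, u 0 k = f 0%N k,
    forall k : 'I_3, v 0 k = f 1%N k & forall k : 'I_3, w 0 k = f 2%N k].
  by split=> k; [exact: (uvwE 0%N) | exact: (uvwE 1%N) | exact: (uvwE 2%N)].
rewrite /triple dotE !crossE (expand_det_row _ 0) big_ord3 /cofactor.
rewrite !(expand_det_row _ 0) !big_ord_recl !big_ord0 /cofactor !det_mx11.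
by rewrite !mxE !uvwE ?uE ?vE ?wE /= /bump /=; ring.
Qed.

Lemma triple_mulmx u v w (A : 'M[R]_3) :
  triple (u *m A) (v *m A) (w *m A) = triple u v w * \det A.
Proof. by rewrite -!det_rows3 -rows3M det_mulmx. Qed.

Lemma dot_mulmx u v : dot u v = (u *m v^T) 0 0.
Proof. by rewrite mxE; apply: eq_bigr => i _; rewrite mxE. Qed.

Lemma enorm_orthogonal u (A : 'M[R]_3) : A *m A^T = 1%:M ->
  enorm (u *m A) = enorm u.
Proof.
move=> AAt; rewrite eq_enorm !dot_mulmx trmx_mul.
by rewrite -mulmxA (mulmxA A) AAt mul1mx.
Qed.

End VectorAlgebra.

(** * Derivatives of matrix-valued functions *)

Section MatrixCalculus.
Variable R : realType.

Lemma derivable_big_sum (V : normedModType R) (I : Type) (s : seq I)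
    (P : pred I) (f : I -> V -> R) x v :
  (forall i, derivable (f i) x v) ->
  derivable (fun y => \sum_(i <- s | P i) f i y) x v.
Proof.
move=> df; elim: s => [|i s IHs].
  by under eq_fun do rewrite big_nil; exact: derivable_cst.
under eq_fun do rewrite big_cons.
by case: (P i); [apply: derivableD; [exact: df | exact: IHs] | exact: IHs].
Qed.

Lemma derivable_big_prod (V : normedModType R) (I : Type) (s : seq I)
    (P : pred I) (f : I -> V -> R) x v :
  (forall i, derivable (f i) x v) ->
  derivable (fun y => \prod_(i <- s | P i) f i y) x v.
Proof.
move=> df; elim: s => [|i s IHs].
  by under eq_fun do rewrite big_nil; exact: derivable_cst.
under eq_fun do rewrite big_cons.
by case: (P i); [apply: derivableM; [exact: df | exact: IHs] | exact: IHs].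
Qed.

Lemma is_derive_mxP (V : normedModType R) m n (M : V -> 'M[R]_(m, n)) D x v :
  is_derive x v M D <-> forall i j, is_derive x v (fun y => M y i j) (D i j).
Proof.
split=> [[dM <-] i j | dM].
  have /derivable_mxP dMij := dM.
  by rewrite derive_mx // mxE; exact: derivableP.
have dM' : derivable M x v by apply/derivable_mxP => i j; case: (dM i j).
apply: DeriveDef => //; rewrite derive_mx //.
by apply/matrixP => i j; rewrite mxE; case: (dM i j).
Qed.

Lemma is_derive_mulmx (V : normedModType R) m n p
    (A : V -> 'M[R]_(m, n)) (B : V -> 'M[R]_(n, p)) A' B' x v :
  is_derive x v A A' -> is_derive x v B B' ->
  is_derive x v (fun y => A y *m B y) (A' *m B x + A x *m B').
Proof.
move=> /is_derive_mxP dA /is_derive_mxP dB; apply/is_derive_mxP => i j.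
have -> : (fun y => (A y *m B y) i j) =
    \sum_k ((fun y => A y i k) * (fun y => B y k j)).
  by apply/funext => y; rewrite mxE fct_sumE.
have dAB k := is_deriveM (dA i k) (dB k j).
apply: is_derive_eq (is_derive_sum dAB) _.
rewrite !mxE -big_split; apply: eq_bigr => k _ /=.
by rewrite addrC; congr (_ + _); exact: mulrC.
Qed.

(** The Leibniz formula is a polynomial in the entries. *)
Lemma derivable_det (V : normedModType R) n (M : V -> 'M[R]_n) x v :
  derivable M x v -> derivable (fun y => \det (M y)) x v.
Proof.
move=> /derivable_mxP dM; rewrite /determinant.
apply: derivable_big_sum => s; apply: derivableM; first exact: derivable_cst.
exact: derivable_big_prod.
Qed.

Lemma derivable_adjugate (V : normedModType R) n (M : V -> 'M[R]_n) x v :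
  derivable M x v -> derivable (fun y => \adj (M y)) x v.
Proof.
move=> /derivable_mxP dM; apply/derivable_mxP => i j.
under eq_fun do rewrite mxE /cofactor.
apply: derivableM; first exact: derivable_cst.
apply: derivable_det; apply/derivable_mxP => k l.
by under eq_fun do rewrite !mxE; exact: dM.
Qed.

Lemma near_unitmx n (M : R -> 'M[R]_n) x :
  derivable M x 1 -> M x \in unitmx -> \forall y \near x, M y \in unitmx.
Proof.
move=> /derivable_det/derivable1_diffP/differentiable_continuous cM.
rewrite unitmxE unitfE => Mx0.
have detM_neq0 := cvgr_neq0 _ cM Mx0.
by near=> y; rewrite unitmxE unitfE; near: y; exact: detM_neq0.
Unshelve. all: by end_near.
Qed.

(** Cramer's formula has differentiable entries. [invmx] follows it only on [unitmx], but
    invertibility persists near [x]. *)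
Lemma derivable_invmx n (M : R -> 'M[R]_n) x :
  derivable M x 1 -> M x \in unitmx -> derivable (fun y => invmx (M y)) x 1.
Proof.
move=> dM Mx; have dN : derivable (fun y => (\det (M y))^-1 *: \adj (M y)) x 1.
  apply/derivable_mxP => i j; under eq_fun do rewrite mxE.
  apply: derivableM.
    by apply: derivableV; [rewrite -unitfE -unitmxE | exact: derivable_det].
  by have /derivable_mxP := derivable_adjugate dM; apply.
apply: near_eq_derivable dN.
by apply: filterS (near_unitmx dM Mx) => y My; rewrite /invmx My.
Qed.

Lemma is_derive_unique (V W : normedModType R) (f : V -> W) a b x v :
  is_derive x v f a -> is_derive x v f b -> a = b.
Proof. by move=> [_ <-] [_ <-]. Qed.

Lemma is_derive_invmx n (M : R -> 'M[R]_n) (D : 'M[R]_n) (x : R) :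
  is_derive x 1 M D -> M x \in unitmx ->
  is_derive x 1 (fun y => invmx (M y)) (- (invmx (M x) *m D *m invmx (M x))).
Proof.
move=> dM Mx; have [dM0 _] := dM.
have dN := derivableP (derivable_invmx dM0 Mx).
apply: is_derive_eq (dN) _.
have dNM := is_derive_mulmx dN dM.
(* The product [invmx (M y) *m M y] is the identity near [x]; differentiating it isolates the
   derivative of the inverse. *)
have d1 : is_derive x 1 (fun y => invmx (M y) *m M y) (0 : 'M[R]_n).
  apply: near_eq_is_derive (is_derive_cst (1%:M : 'M[R]_n) x 1).
  by apply: filterS (near_unitmx dM0 Mx) => y My; rewrite mulVmx.
have /eqP := is_derive_unique dNM d1.
rewrite addr_eq0 => /eqP /(congr1 (mulmx^~ (invmx (M x)))) /=.
by rewrite mulmxK // mulNmx => ->.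
Qed.

Lemma is_derive0_oo_cst (f : R -> R) (a b : R) :
  (forall x, a < x < b -> is_derive x 1 f 0) ->
  forall x y, a < x < b -> a < y < b -> f x = f y.
Proof.
move=> df x y xab yab.
wlog xy : x y xab yab / x <= y.
  by move=> H; case/orP: (le_total x y) => ?; [|apply/esym]; exact: H.
have sub z : z \in `[x, y] -> is_derive z 1 f 0.
  rewrite in_itv /= => /andP[xz zy]; apply: df.
  case/andP: xab => ax _; case/andP: yab => _ yb.
  by rewrite (lt_le_trans ax xz) (le_lt_trans zy yb).
have sub' z : z \in `]x, y[ -> is_derive z 1 f 0.
  by move=> zxy; apply: sub; apply: subset_itv_oo_cc zxy.
have cf : {within `[x, y], continuous f}.
  by apply: derivable_within_continuous => z /sub[].
have [c _ /eqP] := MVT_segment xy sub' cf.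
by rewrite mul0r subr_eq0 => /eqP.
Qed.

Lemma is_derive0_oo_cst_mx m n (M : R -> 'M[R]_(m, n)) (a b : R) :
  (forall x, a < x < b -> is_derive x 1 M 0) ->
  forall x y, a < x < b -> a < y < b -> M x = M y.
Proof.
move=> dM x y xab yab; apply/matrixP => i j.
apply: (@is_derive0_oo_cst (fun z => M z i j) a b) => // z zab.
by have /is_derive_mxP/(_ i j) := dM z zab; rewrite mxE.
Qed.

(** The interval is a neighbourhood of each of its points. This allows identities between the dot
    products of two curves to be differentiated. *)
Lemma eq_derive_oo (V : normedModType R) (f g : R -> V) (a b : R) (f' g' : V) :
  (forall x, a < x < b -> f x = g x) -> forall x, a < x < b ->
  is_derive x 1 f f' -> is_derive x 1 g g' -> f' = g'.
Proof.
move=> fg x xab df dg; apply: is_derive_unique dg.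
apply: near_eq_is_derive df.
near=> y; apply: fg; suff : y \in `]a, b[ by rewrite in_itv.
by near: y; apply: near_in_itvoo; rewrite in_itv.
Unshelve. all: by end_near. Qed.

End MatrixCalculus.

(** * Third-order Taylor expansion to the right of a point *)

Section Taylor.
Variable R : realType.

(** L'Hopital's rule against [h ^+ n.+1], whose derivative is [n.+1%:R * h ^+ n]. *)
Lemma cvg_div_expS (f df : R -> R) (b l : R) n : 0 < b ->
  (forall h : R, 0 < h < b -> is_derive h 1 f (df h)) ->
  f h @[h --> 0^'+] --> 0 ->
  df h / h ^+ n @[h --> 0^'+] --> l ->
  f h / h ^+ n.+1 @[h --> 0^'+] --> l / n.+1%:R.
Proof.
move=> b0 fdf f0 dfl.
apply: (@lhopital_at_right _ f df _ (fun h : R => n.+1%:R * h ^+ n) 0 b) => //.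
- move=> h _; apply: DeriveDef; first exact: exprn_derivable.
  by rewrite exp_derive [_ *: _]mulr1.
- apply: cvg_at_right_filter.
  by have := @exprn_continuous R n.+1 0; rewrite /continuous_at expr0n.
- move=> h; rewrite in_itv /= => /andP[h0 _].
  by rewrite mulf_neq0 ?pnatr_eq0 // expf_neq0 // gt_eqF.
have -> : (fun h => df h / (n.+1%:R * h ^+ n)) =
    (fun h => df h / h ^+ n / n.+1%:R).
  by apply/funext => h; rewrite invfM mulrCA mulrC.
by apply: cvgM => //; exact: cvg_cst.
Qed.

Lemma is_derive_shiftl (f : R -> R) (t h df : R) :
  is_derive (t + h) 1 f df -> is_derive h 1 (fun x => f (t + x)) df.
Proof.
move=> dfth; have dt : is_derive h 1 (fun x => t + x) (1 : R).
  apply: is_derive_eq (is_deriveD (is_derive_cst t h 1) (is_derive_id h 1)) _.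
  exact: add0r.
by apply: is_derive_eq (is_derive1_comp dfth dt) _; rewrite mulr1.
Qed.

Lemma is_derive_cvg_right (f : R -> R) (t df : R) : is_derive t 1 f df ->
  (f (t + h) - f t) / h @[h --> 0^'+] --> df.
Proof.
move=> [dft <-]; have := cvg_dnbhs_at_right dft.
apply: cvg_trans; apply: near_eq_cvg; near=> h.
by rewrite /= [h%:A]mulr1 [h + t]addrC; exact: mulrC.
Unshelve. all: by end_near. Qed.

(** The second derivative [f2] is assumed differentiable at [t] only. Hence l'Hopital's rule is
    applied twice, and the quotient that remains converges by the definition of the derivative of
    [f2] at [t]. *)
Lemma taylor_peano3 (f f1 f2 : R -> R) (f3 a b t : R) : a < t < b ->
  (forall s : R, a < s < b -> is_derive s 1 f (f1 s)) ->
  (forall s : R, a < s < b -> is_derive s 1 f1 (f2 s)) ->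
  is_derive t 1 f2 f3 ->
  (f (t + h) - f t - h * f1 t - h ^+ 2 / 2 * f2 t) / h ^+ 3 @[h --> 0^'+]
    --> f3 / 6.
Proof.
move=> /andP[a_t tb] df df1 df2.
have tab (h : R) : 0 <= h < b - t -> a < t + h < b.
  by case/andP=> h0 hb; rewrite ltr_wpDr //= -ltrBrDl.
have bt0 : 0 < b - t by rewrite subr_gt0.
(* [k] is the numerator in the claim, and [k1] will be its derivative. *)
pose k1 h := f1 (t + h) - f1 t - h * f2 t.
pose k h := f (t + h) - f t - h * f1 t - h ^+ 2 / 2 * f2 t.
(* The value [h = 0] is included because differentiability there gives the continuity by which [k]
   and [k1] tend to [0]. *)
have dk1 (h : R) : 0 <= h < b - t -> is_derive h 1 k1 (f2 (t + h) - f2 t).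
  move=> /tab /df1 /is_derive_shiftl df1h.
  have := is_deriveB (is_deriveB df1h (is_derive_cst (f1 t) h 1))
    (is_deriveM (is_derive_id h (1 : R)) (is_derive_cst (f2 t) h 1)).
  by move/is_derive_eq; apply; rewrite subr0 scaler0 add0r [_%:A]mulr1.
have dk (h : R) : 0 <= h < b - t -> is_derive h 1 k (k1 h).
  move=> /tab /df /is_derive_shiftl dfh.
  have := is_deriveB (is_deriveB (is_deriveB dfh (is_derive_cst (f t) h 1))
    (is_deriveM (is_derive_id h (1 : R)) (is_derive_cst (f1 t) h 1)))
    (is_deriveM (is_deriveM (is_deriveX 2 (is_derive_id h (1 : R)))
       (is_derive_cst (2^-1 : R) h 1)) (is_derive_cst (f2 t) h 1)).
  move/is_derive_eq; apply; rewrite /k1 /GRing.scale /=.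
  by field.
have cvg0 (g : R -> R) (dg : R) : is_derive (0 : R) 1 g dg -> g 0 = 0 ->
    g h @[h --> 0^'+] --> 0.
  move=> [/derivable1_diffP/differentiable_continuous cg _] g0.
  by apply: cvg_at_right_filter; rewrite -[X in _ --> X]g0; exact: cg.
have b0 : (0 : R) <= 0 < b - t by apply/andP.
have ltW' (h : R) : 0 < h < b - t -> 0 <= h < b - t by case/andP=> /ltW -> ->.
(* Each use of l'Hopital's rule accounts for one of the factors [3] and [2]. *)
have -> : f3 / 6 = f3 / 1%:R / 2%:R / 3%:R :> R by field.
apply: (cvg_div_expS bt0 (df := k1)) => [h /ltW'/dk //||].
  by apply: cvg0 (dk _ b0) _; rewrite /k addr0; ring.
apply: (cvg_div_expS bt0 (df := fun h => f2 (t + h) - f2 t)).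
- by move=> h /ltW'/dk1.
- by apply: cvg0 (dk1 _ b0) _; rewrite /k1 addr0; ring.
rewrite divr1; under eq_fun do rewrite expr1; exact: is_derive_cvg_right.
Qed.

End Taylor.

(** * Rate of change of a normalised vector *)

Section LocalRotation.
Variable R : realType.
Implicit Types (u v : 'rV[R]_3) (c : R -> 'rV[R]_3) (t k : R).

Lemma cvg_enorm_shift u v (s : R -> R) : s h @[h --> 0^'+] --> 0 ->
  enorm (u + s h *: v) @[h --> 0^'+] --> enorm u.
Proof.
move=> s0; have sqrtc := @sqrt_continuous R (dot u u).
apply: (continuous_cvg _ sqrtc).
have -> : (fun h => dot (u + s h *: v) (u + s h *: v)) =
    (fun h => dot u u + s h * (2 * dot u v + s h * dot v v)).
  apply/funext => h; rewrite !(dotDl, dotDr, dotZl, dotZr) (dotC v u); ring.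
rewrite -[X in _ --> X]addr0.
rewrite -[X in _ --> _ + X](mul0r (2 * dot u v + 0 * dot v v)).
apply: cvgD; first exact: cvg_cst.
apply: cvgM => //; apply: cvgD; first exact: cvg_cst.
by apply: cvgM => //; exact: cvg_cst.
Qed.

Section Normalize.
Variables (u v : 'rV[R]_3) (p q : R -> R) (k : R).
Hypothesis u0 : u != 0.
Hypothesis p_gt0 : \forall h \near 0^'+, 0 < p h.
Hypothesis cvgk : q h / p h / h @[h --> 0^'+] --> k.

Let w h := p h *: u + q h *: v.
Let s h := q h / p h.
Let m h := enorm (u + s h *: v).

Let cvgs : s h @[h --> 0^'+] --> 0.
Proof.
have : (q h / p h / h * h) @[h --> 0^'+] --> k * 0.
  by apply: cvgM => //; apply: cvg_at_right_filter; exact: cvg_id.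
rewrite mulr0; apply: cvg_trans; apply: near_eq_cvg; near=> h.
by rewrite divfK // gt_eqF.
Unshelve. all: by end_near. Qed.

Let cvgm : m h @[h --> 0^'+] --> enorm u.
Proof. exact: cvg_enorm_shift. Qed.

Let u_gt0 : 0 < enorm u. Proof. by rewrite enorm_gt0. Qed.

Let m_gt0 : \forall h \near 0^'+, 0 < m h.
Proof. exact: (cvgr_gt _ cvgm _ u_gt0). Qed.

(** Normalisation forgets the positive factor [p h], so only the ratio [s h] of the coefficients
    matters. *)
Let normalizeE : \forall h \near 0^'+,
  (enorm (w h))^-1 *: w h = (m h)^-1 *: (u + s h *: v).
Proof.
near=> h; have ph : 0 < p h by near: h; exact: p_gt0.
have -> : w h = p h *: (u + s h *: v).
  by rewrite scalerDr scalerA mulrC divfK // gt_eqF.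
by rewrite enormZ gtr0_norm // invfM scalerA mulrAC mulVf ?mul1r // gt_eqF.
Unshelve. all: by end_near. Qed.

Lemma cvg_normalize :
  (enorm (w h))^-1 *: w h @[h --> 0^'+] --> (enorm u)^-1 *: u.
Proof.
have : (m h)^-1 *: (u + s h *: v) @[h --> 0^'+] -->
    (enorm u)^-1 *: (u + 0 *: v).
  apply: cvgZ; first by apply: cvgV => //; rewrite gt_eqF.
  by apply: cvgD; [exact: cvg_cst | apply: cvgZ => //; exact: cvg_cst].
rewrite scale0r addr0; apply: cvg_trans; apply: near_eq_cvg.
by near=> h; apply/esym; near: h; exact: normalizeE.
Unshelve. all: by end_near. Qed.

(** The map [x / |x|] has at [u], in the direction [v], the derivative [reject u v / |u|^3]; the
    ratio [s] leaves [0] with speed [k]. *)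
Lemma cvg_normalize_rate :
  h^-1 *: ((enorm (w h))^-1 *: w h - (enorm u)^-1 *: u) @[h --> 0^'+] -->
  (k / enorm u ^+ 3) *: reject u v.
Proof.
(* These are the coefficients of [v] and [u] in the difference quotient. In [c2] the difference
   [enorm u - m h] is rationalised to [(|u|^2 - m^2) / (|u| + m)], so that [h] divides [s h] only
   and every factor has a limit. *)
pose c1 h := s h / h / m h.
pose c2 h := - (s h / h * (2 * dot u v + s h * dot v v)) / (enorm u + m h)
  / (m h * enorm u).
have un0 : enorm u != 0 by rewrite gt_eqF.
have cvg12 : c1 h *: v + c2 h *: u @[h --> 0^'+] --> k / enorm u *: v +
    (- (k * (2 * dot u v + 0 * dot v v)) / (enorm u + enorm u)
      / (enorm u * enorm u)) *: u.
  apply: cvgD; apply: cvgZ; try exact: cvg_cst.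
    by apply: cvgM => //; exact: cvgV.
  apply: cvgM; last first.
    by apply: cvgV; [rewrite mulf_neq0 | apply: cvgM => //; exact: cvg_cst].
  apply: cvgM; last first.
    apply: cvgV; first by rewrite gt_eqF // addr_gt0.
    by apply: cvgD => //; exact: cvg_cst.
  apply: cvgN; apply: cvgM; first exact: cvgk.
  apply: cvgD; first exact: cvg_cst.
  by apply: cvgM; [exact: cvgs | exact: cvg_cst].
have -> : (k / enorm u ^+ 3) *: reject u v = k / enorm u *: v +
    (- (k * (2 * dot u v + 0 * dot v v)) / (enorm u + enorm u)
      / (enorm u * enorm u)) *: u.
  rewrite /reject scalerDr addrC scalerA scalerN scalerA -scaleNr -sqr_enorm.
  congr (_ *: _ + _ *: _).
    by field.
  by field; rewrite un0 gt_eqF // addr_gt0.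
apply: cvg_trans cvg12; apply: near_eq_cvg; near=> h.
have -> : (enorm (w h))^-1 *: w h = (m h)^-1 *: (u + s h *: v).
  by near: h; exact: normalizeE.
have h0 : h != 0 by rewrite gt_eqF.
have mh0 : 0 < m h by near: h; exact: m_gt0.
have umE : enorm u - m h =
    - (s h * (2 * dot u v + s h * dot v v)) / (enorm u + m h).
  apply: (canRL (mulfK _)); first by rewrite gt_eqF // addr_gt0.
  rewrite -subr_sqr !sqr_enorm !(dotDl, dotDr, dotZl, dotZr) (dotC v u); ring.
rewrite (scalerDr (m h)^-1) scalerA addrAC -scalerBl scalerDr !scalerA addrC.
have -> : (m h)^-1 - (enorm u)^-1 = (enorm u - m h) / (m h * enorm u).
  by field; rewrite un0 gt_eqF.
rewrite umE /c1 /c2.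
by congr (_ *: _ + _ *: _); field; rewrite ?un0 h0 !gt_eqF // addr_gt0.
Unshelve. all: by end_near. Qed.

End Normalize.

(** * Coordinates of a chord in the frame of derivatives *)

Lemma class_C3_is_derive c t0 t1 n t : class_C3 c t0 t1 -> (n < 3)%N ->
  t0 < t < t1 -> is_derive t 1 (derive1n n c) (derive1n n.+1 c t).
Proof.
move=> cC3 n3 tt; have [d0 d1 d2 _] := cC3 t tt.
have dn : derivable (derive1n n c) t 1.
  by case: n n3 => [|[|[|n]]] n3;
    [exact: d0 | exact: d1 | exact: d2 | discriminate n3].
apply: DeriveDef; first exact: dn.
by rewrite derive1nS derive1E.
Qed.

Lemma curve_frame_unit c t :
  triple (derive1n 1 c t) (derive1n 2 c t) (derive1n 3 c t) != 0 ->
  curve_frame c t \in unitmx.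
Proof.
rewrite -det_rows3 unitmxE unitfE; congr (\det _ != 0).
by apply/row_matrixP; apply: ord3P; rewrite row_rows3 rowK.
Qed.

(** Taylor's formula writes the chord as [h c' + h^2/2 c''] plus [h^3] times a vector tending to
    [c''' / 6]. Multiplication by the inverse frame turns [c'], [c''], [c'''] into the standard
    basis, and the coordinates can be read off. *)
Lemma cvg_gcoord c t0 t1 t : class_C3 c t0 t1 -> nondegenerate_curve c t0 t1 ->
  t0 < t < t1 ->
  [/\ gcoord c t h 0 0 / h @[h --> 0^'+] --> (1 : R),
      gcoord c t h 0 1 / h ^+ 2 @[h --> 0^'+] --> (2^-1 : R) &
      gcoord c t h 0 2%:R / h ^+ 3 @[h --> 0^'+] --> (6^-1 : R)].
Proof.
move=> cC3 cnd tt; set F := curve_frame c t.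
have Fu : F \in unitmx by apply: curve_frame_unit; exact: cnd.
pose e (i : 'I_3) : 'rV[R]_3 := delta_mx 0 i.
have eE i j : e i 0 j = (j == i)%:R by rewrite mxE eqxx.
have deriveF (i : 'I_3) : derive1n i.+1 c t *m invmx F = e i.
  rewrite -[derive1n _ c t](rowK (fun i : 'I_3 => derive1n i.+1 c t)).
  by rewrite -row_mul mulmxV // rowE mulmx1.
have [dF0 dF1 dF2] : [/\ derive1n 1 c t *m invmx F = e 0,
    derive1n 2 c t *m invmx F = e 1 & derive1n 3 c t *m invmx F = e 2%:R].
  by split; [exact: (deriveF 0) | exact: (deriveF 1) | exact: (deriveF 2%:R)].
have coordE (x y z w : 'rV[R]_3) (l1 l2 l3 : R) i :
    (l1 *: (x - y - l2 *: z - l3 *: w)) 0 i =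
    l1 * (x 0 i - y 0 i - l2 * z 0 i - l3 * w 0 i) by rewrite !mxE.
(* The scaled Taylor remainder; [G] below holds its coordinates in the frame. *)
pose rem h := h ^- 3 *: (c (t + h) - c t - h *: derive1n 1 c t
  - (h ^+ 2 / 2) *: derive1n 2 c t).
have cvg_rem i : rem h 0 i @[h --> 0^'+] --> derive1n 3 c t 0 i / 6.
  have dc n s : (n < 3)%N -> t0 < s < t1 ->
      is_derive s 1 (fun x => derive1n n c x 0 i) (derive1n n.+1 c s 0 i).
    by move=> n3 ss; have /is_derive_mxP := class_C3_is_derive cC3 n3 ss; exact.
  have := taylor_peano3 tt (fun s => @dc 0%N s isT) (fun s => @dc 1%N s isT)
    (@dc 2%N t isT tt).
  apply: cvg_trans; apply: near_eq_cvg; near=> h.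
  by rewrite /rem coordE; exact: mulrC.
pose G h := rem h *m invmx F.
have cvgG i : G h 0 i @[h --> 0^'+] --> (e 2%:R 0 i / 6 : R).
  have -> : (e 2%:R 0 i : R) / 6 =
      \sum_k derive1n 3 c t 0 k / 6 * invmx F k i.
    by rewrite -dF2 mxE mulr_suml; apply: eq_bigr => k _; rewrite mulrAC.
  under eq_fun do rewrite mxE big_ord3.
  rewrite big_ord3.
  by apply: cvgD; [apply: cvgD|]; apply: cvgM => //; exact: cvg_cst.
have gE h i : 0 < h -> gcoord c t h 0 i =
    h ^+ 3 * G h 0 i + h ^+ 2 / 2 * e 1 0 i + h * e 0 0 i.
  move=> h0; suff -> : gcoord c t h = h ^+ 3 *: G h + (h ^+ 2 / 2) *: e 1
      + h *: e 0 by rewrite !mxE.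
  rewrite /gcoord -dF0 -dF1 /G !scalemxAl -!mulmxDl /rem scalerA.
  rewrite divff; last first.
    by rewrite expf_neq0 // gt_eqF.
  by rewrite scale1r !subrK.
have cvgh : h @[h --> (0 : R)^'+] --> (0 : R).
  by apply: cvg_at_right_filter; exact: cvg_id.
split.
- have : 1 + h * (h * G h 0 0) @[h --> 0^'+] -->
      (1 + 0 * (0 * (e 2%:R 0 0 / 6)) : R).
    by apply: cvgD; [exact: cvg_cst | apply: cvgM => //; exact: cvgM].
  rewrite mul0r addr0; apply: cvg_trans; apply: near_eq_cvg; near=> h.
  have h0 : 0 < h by [].
  by rewrite gE // !eE /=; field; rewrite gt_eqF.
- have : 2^-1 + h * G h 0 1 @[h --> 0^'+] -->
      (2^-1 + 0 * (e 2%:R 0 1 / 6) : R).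
    by apply: cvgD; [exact: cvg_cst | exact: cvgM].
  rewrite mul0r addr0; apply: cvg_trans; apply: near_eq_cvg; near=> h.
  have h0 : 0 < h by [].
  by rewrite gE // !eE /=; field; rewrite gt_eqF.
- have := cvgG 2%:R; rewrite eE eqxx mul1r.
  apply: cvg_trans; apply: near_eq_cvg; near=> h.
  have h0 : 0 < h by [].
  by rewrite gE // !eE /=; field; rewrite gt_eqF.
Unshelve. all: by end_near. Qed.

End LocalRotation.

(** * Norms of the projective rotational velocities *)

Section ProjectiveRotation.
Variable R : realType.
Implicit Types (c : R -> 'rV[R]_3) (i j : 'I_3) (t k : R).

(** The hypothesis on the quotient says that coordinate [j] is one order of [h] smaller than
    coordinate [i]. The normalised vector then tends to the direction of derivative [i + 1], which
    identifies [evec0], and its rate of change is known. *)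
Lemma psi_reject c i j t k : derive1n i.+1 c t != 0 ->
  (\forall h \near 0^'+, 0 < gcoord c t h 0 i) ->
  gcoord c t h 0 j / gcoord c t h 0 i / h @[h --> 0^'+] --> k ->
  psi c i j t = (k / enorm (derive1n i.+1 c t) ^+ 3) *:
    reject (derive1n i.+1 c t) (derive1n j.+1 c t).
Proof.
move=> ci0 gi_gt0 gji; rewrite /psi.
have -> : evec0 c i j t =
    (enorm (derive1n i.+1 c t))^-1 *: derive1n i.+1 c t.
  by apply/cvg_lim => //; exact: (cvg_normalize _ ci0 gi_gt0 gji).
by apply/cvg_lim => //; exact: (cvg_normalize_rate ci0 gi_gt0 gji).
Qed.

Lemma near_pos_of_div (f g : R -> R) (l : R) :
  f h / g h @[h --> 0^'+] --> l -> 0 < l ->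
  (forall h, 0 < h -> 0 < g h) -> \forall h \near 0^'+, 0 < f h.
Proof.
move=> fgl l0 g0; have fg_gt0 := cvgr_gt _ fgl _ l0.
near=> h; have gh : 0 < g h by exact: g0.
by rewrite -(divfK (lt0r_neq0 gh) (f h)) mulr_gt0 //; near: h; exact: fg_gt0.
Unshelve. all: by end_near. Qed.

Section Curve.
Variables (c : R -> 'rV[R]_3) (t0 t1 t : R).
Hypothesis cC3 : class_C3 c t0 t1.
Hypothesis cnd : nondegenerate_curve c t0 t1.
Hypothesis tt : t0 < t < t1.

Lemma derive1_neq0 : derive1n 1 c t != 0.
Proof.
by apply: contra (cnd tt) => /eqP ->; rewrite -tripleC /triple dotC dot0v.
Qed.

Lemma derive2_neq0 : derive1n 2 c t != 0.
Proof.
by apply: contra (cnd tt) => /eqP ->; rewrite tripleC /triple dotC dot0v.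
Qed.

(** The leading terms [h^2 / 2] and [h] have ratio [h / 2], whence the constant [2]. *)
Lemma enorm_psi12 : enorm (psi12 c t) =
  enorm (reject (derive1n 1 c t) (derive1n 2 c t)) /
  (2 * enorm (derive1n 1 c t) ^+ 3).
Proof.
have [g0 g1 _] := cvg_gcoord cC3 cnd tt.
have c0 : 0 < enorm (derive1n 1 c t) ^+ 3.
  by rewrite exprn_gt0 // enorm_gt0 derive1_neq0.
suff -> : psi12 c t = (2^-1 / enorm (derive1n 1 c t) ^+ 3) *:
    reject (derive1n 1 c t) (derive1n 2 c t).
  by rewrite enormZ gtr0_norm ?divr_gt0 ?invr_gt0 // mulrC -invfM.
apply: (@psi_reject c 0 1); first exact: derive1_neq0.
  exact: near_pos_of_div g0 _ _.
have : (gcoord c t h 0 1 / h ^+ 2) / (gcoord c t h 0 0 / h) @[h --> 0^'+] -->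
    (2^-1 / 1 : R).
  by apply: cvgM => //; apply: cvgV => //; exact: oner_neq0.
rewrite divr1; apply: cvg_trans; apply: near_eq_cvg.
have g0_gt0 := near_pos_of_div g0 ltr01 (fun h h0 => h0).
near=> h; have gh : 0 < gcoord c t h 0 0 by near: h.
by field; rewrite !gt_eqF.
Unshelve. all: by end_near. Qed.

(** The leading terms [h^3 / 6] and [h^2 / 2] have ratio [h / 3], whence the constant [3]. *)
Lemma enorm_psi23 : enorm (psi23 c t) =
  enorm (reject (derive1n 2 c t) (derive1n 3 c t)) /
  (3 * enorm (derive1n 2 c t) ^+ 3).
Proof.
have [_ g1 g2] := cvg_gcoord cC3 cnd tt.
have c0 : 0 < enorm (derive1n 2 c t) ^+ 3.
  by rewrite exprn_gt0 // enorm_gt0 derive2_neq0.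
have h2_gt0 (h : R) : 0 < h -> 0 < h ^+ 2 by move=> ?; rewrite exprn_gt0.
have half_gt0 : (0 : R) < 2^-1 by rewrite invr_gt0.
have g1_gt0 := near_pos_of_div g1 half_gt0 h2_gt0.
suff -> : psi23 c t = (3^-1 / enorm (derive1n 2 c t) ^+ 3) *:
    reject (derive1n 2 c t) (derive1n 3 c t).
  by rewrite enormZ gtr0_norm ?divr_gt0 ?invr_gt0 // mulrC -invfM.
apply: (@psi_reject c 1 2%:R); first exact: derive2_neq0.
  exact: g1_gt0.
have : (gcoord c t h 0 2%:R / h ^+ 3) / (gcoord c t h 0 1 / h ^+ 2)
    @[h --> 0^'+] --> (6^-1 / 2^-1 : R).
  by apply: cvgM => //; apply: cvgV => //; rewrite gt_eqF.
rewrite (_ : 6^-1 / 2^-1 = 3^-1 :> R); last by field.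
apply: cvg_trans; apply: near_eq_cvg.
near=> h; have gh : 0 < gcoord c t h 0 1 by near: h.
by field; rewrite !gt_eqF.
Unshelve. all: by end_near. Qed.

End Curve.

(** * Product rules for vector functions *)

Lemma is_derive_dot (u v : R -> 'rV[R]_3) (u' v' : 'rV[R]_3) t :
  is_derive t 1 u u' -> is_derive t 1 v v' ->
  is_derive t 1 (fun s => dot (u s) (v s)) (dot u' (v t) + dot (u t) v').
Proof.
move=> du /is_derive_mxP dv.
have dvT : is_derive t 1 (fun s => (v s)^T) v'^T.
  apply/is_derive_mxP => i j; rewrite mxE.
  by under eq_fun do rewrite mxE; exact: dv.
have /is_derive_mxP/(_ 0 0) := is_derive_mulmx du dvT.
rewrite mxE -!dot_mulmx.
by under eq_fun do rewrite -dot_mulmx.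
Qed.

Lemma is_derive_cross (u v : R -> 'rV[R]_3) (u' v' : 'rV[R]_3) t :
  is_derive t 1 u u' -> is_derive t 1 v v' ->
  is_derive t 1 (fun s => cross (u s) (v s)) (cross u' (v t) + cross (u t) v').
Proof.
move=> /is_derive_mxP du /is_derive_mxP dv; apply/is_derive_mxP => i j.
under eq_fun do rewrite mxE.
have dM (k l : 'I_3) := is_deriveM (du 0 k) (dv 0 l).
have := is_deriveB (dM (j + 1) (j + 2%:R)) (dM (j + 2%:R) (j + 1)).
move/is_derive_eq; apply.
by rewrite ord1 !mxE /GRing.scale /=; ring.
Qed.

Lemma is_derive_rows3 (u v w : R -> 'rV[R]_3) (u' v' w' : 'rV[R]_3) t :
  is_derive t 1 u u' -> is_derive t 1 v v' -> is_derive t 1 w w' ->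
  is_derive t 1 (fun s => rows3 (u s) (v s) (w s)) (rows3 u' v' w').
Proof.
move=> /is_derive_mxP du /is_derive_mxP dv /is_derive_mxP dw.
apply/is_derive_mxP => i j; rewrite mxE; under eq_fun do rewrite mxE.
by move: i; apply: ord3P => /=; [exact: du | exact: dv | exact: dw].
Qed.

End ProjectiveRotation.

(** * Rotations between moving frames *)

Section Congruence.
Variable R : realType.
Implicit Types (a b d : 'rV[R]_3).

Definition mframe a b := rows3 a b (cross a b).
(** The derivative of [mframe a b] when [a' = b] and [b' = d]; in the last row the term [cross b b]
    vanishes. *)
Definition mframe' a b d := rows3 b d (cross a d).

Lemma det_mframe a b : \det (mframe a b) = dot a a * dot b b - dot a b ^+ 2.
Proof. by rewrite det_rows3 /triple dot_cross (dotC b a). Qed.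

(** The determinant is [|a x b|^2], and [a x b = 0] would make the triple product vanish. *)
Lemma mframe_unit a b d : triple a b d != 0 -> mframe a b \in unitmx.
Proof.
move=> abd0; rewrite unitmxE unitfE det_rows3 /triple dot_eq0.
by apply: contra abd0 => /eqP ab0; rewrite /triple ab0 dot0v.
Qed.

Lemma mframe_gram a b : mframe a b *m (mframe a b)^T =
  \matrix_(i, j) (nth [::] [:: [:: dot a a; dot a b; 0];
    [:: dot a b; dot b b; 0];
    [:: 0; 0; dot a a * dot b b - dot a b ^+ 2]] i)`_j.
Proof.
rewrite rows3_gram; apply/matrixP; apply: ord3P; apply: ord3P;
  rewrite !mxE /= !dotE ?crossE; ring.
Qed.

(** Here the signed triple product enters, through [d . (a x b)] and [(a x d) . b]. With it and the
    dot products other than [dot d d], all entries are determined. *)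
Lemma mframe'_gram a b d : mframe' a b d *m (mframe a b)^T =
  \matrix_(i, j) (nth [::] [:: [:: dot a b; dot b b; 0];
    [:: dot a d; dot b d; triple a b d];
    [:: 0; - triple a b d; dot a a * dot b d - dot a b * dot a d]] i)`_j.
Proof.
rewrite rows3_gram; apply/matrixP; apply: ord3P; apply: ord3P;
  rewrite !mxE /= /triple !dotE ?crossE; ring.
Qed.

(** With [M^-T] the inverse transpose, [Q Q^T = M^-1 (N N^T) M^-T = 1]. Likewise
    [D = E N^T M^-T = E Q^T], and [Q^T Q = 1] because [Q] is square. *)
Lemma same_gram n (M N D E : 'M[R]_n) : M \in unitmx ->
  M *m M^T = N *m N^T -> D *m M^T = E *m N^T ->
  let Q := invmx M *m N in Q *m Q^T = 1%:M /\ D *m Q = E.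
Proof.
move=> Mu MN DE Q.
have VT : M^T *m (invmx M)^T = 1%:M by rewrite -trmx_mul mulVmx // trmx1.
have QQ : Q *m Q^T = 1%:M.
  rewrite trmx_mul mulmxA -(mulmxA (invmx M)) -MN mulmxA mulVmx // mul1mx.
  exact: VT.
split=> //; have -> : D = E *m Q^T.
  by rewrite trmx_mul mulmxA -DE -mulmxA VT mulmx1.
by rewrite -mulmxA (mulmx1C QQ) mulmx1.
Qed.

(** Orthogonality comes from the Gram matrices. The determinant is [1], not [-1], because both
    frames have the same determinant [|a x b|^2]. *)
Lemma mframe_rotation a b d a1 b1 d1 :
  dot a1 a1 = dot a a -> dot a1 b1 = dot a b -> dot b1 b1 = dot b b ->
  dot a1 d1 = dot a d -> dot b1 d1 = dot b d ->
  triple a1 b1 d1 = triple a b d ->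
  triple a b d != 0 ->
  let Q := invmx (mframe a b) *m mframe a1 b1 in
  [/\ Q *m Q^T = 1%:M, \det Q = 1 & mframe' a b d *m Q = mframe' a1 b1 d1].
Proof.
move=> aa ab bb ad bd abd abd0 Q; have Mu := mframe_unit abd0.
have [QQ DQ] : Q *m Q^T = 1%:M /\ mframe' a b d *m Q = mframe' a1 b1 d1.
  apply: same_gram => //; first by rewrite !mframe_gram aa ab bb.
  by rewrite !mframe'_gram aa ab bb ad bd abd.
split=> //; rewrite det_mulmx det_inv !det_mframe aa ab bb -det_mframe mulVf //.
by rewrite -unitfE -unitmxE.
Qed.

Lemma rigid_motion_affine (Q : 'M[R]_3) k : Q *m Q^T = 1%:M -> \det Q = 1 ->
  rigid_motion (fun p => p *m Q + k).
Proof.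
move=> QQ detQ; have sub p q : p *m Q + k - (q *m Q + k) = (p - q) *m Q.
  by rewrite opprD addrACA subrr addr0 mulmxBl.
split=> [p q | p u v w]; first by rewrite sub enorm_orthogonal.
by rewrite !sub !(addrC p) !addrK triple_mulmx detQ mulr1.
Qed.

(** * Congruence of curves with equal dot and triple products *)

Section Curves.
Variables (t0 t1 : R) (r r1 : R -> 'rV[R]_3).
Hypotheses (r_C3 : class_C3 r t0 t1) (r1_C3 : class_C3 r1 t0 t1).
Hypothesis r_nd : nondegenerate_curve r t0 t1.
Hypothesis dot11 : forall t, t0 < t < t1 ->
  dot (derive1n 1 r1 t) (derive1n 1 r1 t) =
  dot (derive1n 1 r t) (derive1n 1 r t).
Hypothesis dot12 : forall t, t0 < t < t1 ->
  dot (derive1n 1 r1 t) (derive1n 2 r1 t) =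
  dot (derive1n 1 r t) (derive1n 2 r t).
Hypothesis dot22 : forall t, t0 < t < t1 ->
  dot (derive1n 2 r1 t) (derive1n 2 r1 t) =
  dot (derive1n 2 r t) (derive1n 2 r t).
Hypothesis dot13 : forall t, t0 < t < t1 ->
  dot (derive1n 1 r1 t) (derive1n 3 r1 t) =
  dot (derive1n 1 r t) (derive1n 3 r t).
Hypothesis dot23 : forall t, t0 < t < t1 ->
  dot (derive1n 2 r1 t) (derive1n 3 r1 t) =
  dot (derive1n 2 r t) (derive1n 3 r t).
Hypothesis triple123 : forall t, t0 < t < t1 ->
  triple (derive1n 1 r1 t) (derive1n 2 r1 t) (derive1n 3 r1 t) =
  triple (derive1n 1 r t) (derive1n 2 r t) (derive1n 3 r t).

Let M c t := mframe (derive1n 1 c t) (derive1n 2 c t).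
Let D c t := mframe' (derive1n 1 c t) (derive1n 2 c t) (derive1n 3 c t).
Let Q t := invmx (M r t) *m M r1 t.

Let is_derive_M c t : class_C3 c t0 t1 -> t0 < t < t1 ->
  is_derive t 1 (M c) (D c t).
Proof.
move=> cC3 tt; have d1 := @class_C3_is_derive _ c t0 t1 1 t cC3 isT tt.
have d2 := @class_C3_is_derive _ c t0 t1 2 t cC3 isT tt.
have := is_derive_cross d1 d2; rewrite crossvv add0r => d12.
exact: (is_derive_rows3 d1 d2 d12).
Qed.

Let M_unit t : t0 < t < t1 -> M r t \in unitmx.
Proof. by move=> tt; exact: mframe_unit (r_nd tt). Qed.

Let Q_spec t : t0 < t < t1 ->
  [/\ Q t *m (Q t)^T = 1%:M, \det (Q t) = 1 & D r t *m Q t = D r1 t].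
Proof.
move=> tt; exact: (mframe_rotation (dot11 tt) (dot12 tt) (dot22 tt) (dot13 tt)
  (dot23 tt) (triple123 tt) (r_nd tt)).
Qed.

Let Q_cst s t : t0 < s < t1 -> t0 < t < t1 -> Q s = Q t.
Proof.
apply: is_derive0_oo_cst_mx => x xt.
have dM := is_derive_M r_C3 xt; have dM1 := is_derive_M r1_C3 xt.
apply: is_derive_eq (is_derive_mulmx (is_derive_invmx dM (M_unit xt)) dM1) _.
(* Writing [D r1 x] as [D r x *m Q x] makes the two terms of the product rule opposite. *)
have [_ _ <-] := Q_spec xt.
by rewrite mulNmx -!mulmxA addrC subrr.
Qed.

Lemma congruent_curves : t0 < t1 -> exists T : 'rV[R]_3 -> 'rV[R]_3,
  rigid_motion T /\ forall t, t0 < t < t1 -> r1 t = T (r t).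
Proof.
(* The midpoint serves as base point: it fixes the value of the constant [Q] and the translation. *)
move=> t01; pose s := (t0 + t1) / 2.
have ss : t0 < s < t1 by rewrite !midf_lt.
exists (fun p => p *m Q s + (r1 s - r s *m Q s)); split.
  by have [QQ detQ _] := Q_spec ss; exact: rigid_motion_affine.
move=> t tt; apply/eqP; rewrite addrC -subr_eq; apply/eqP.
pose f x := r1 x - r x *m Q s.
apply: (@is_derive0_oo_cst_mx _ _ _ f t0 t1) => // x xt.
have d := @class_C3_is_derive _ r t0 t1 0 x r_C3 isT xt.
have d1 := @class_C3_is_derive _ r1 t0 t1 0 x r1_C3 isT xt.
have dQ := is_derive_mulmx d (is_derive_cst (Q s) x 1).
apply: is_derive_eq (is_deriveB d1 dQ) _.
(* The first row of this identity is [r1' = r' Q], so [f] has zero derivative. *)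
have MQ : M r1 x = M r x *m Q s by rewrite (Q_cst ss xt) mulKVmx // M_unit.
have := congr1 (row 0) MQ; rewrite rows3M !row_rows3 /= => ->.
by rewrite mulmx0 addr0 subrr.
Qed.

End Curves.
End Congruence.

(** * Recovering the Gram matrix and the triple product from the local data *)

(** For [v = u'] the sum is the derivative of [dot u u], that is [2 (u . v)]. *)
Lemma dot_polar_inj (R : realType) (u v u1 v1 : 'rV[R]_3) :
  dot v1 u1 + dot u1 v1 = dot v u + dot u v -> dot u1 v1 = dot u v.
Proof. by rewrite (dotC v1) (dotC v); lra. Qed.

(** After the common denominator is cancelled, [dot_reject] is an affine function of [dot v v] with
    nonzero slope [(u . u)^2]. The constant [k] is [2] for [psi12] and [3] for [psi23]. *)
Lemma dot_reject_inj (R : realType) (u v u1 v1 : 'rV[R]_3) (k : R) :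
  u != 0 -> k != 0 -> dot u1 u1 = dot u u -> dot u1 v1 = dot u v ->
  enorm (reject u1 v1) / (k * enorm u1 ^+ 3) =
  enorm (reject u v) / (k * enorm u ^+ 3) -> dot v1 v1 = dot v v.
Proof.
move=> u0 k0 uu uv; have -> : enorm u1 = enorm u by apply/eq_enorm.
have un0 : k * enorm u ^+ 3 != 0.
  by rewrite mulf_neq0 // expf_neq0 // gt_eqF // enorm_gt0.
rewrite -dot_eq0 in u0.
have kinj : injective ( *%R^~ (k * enorm u ^+ 3)^-1 ).
  by apply: mulIf; rewrite invr_eq0.
move/kinj/eq_enorm; rewrite !dot_reject uu uv.
by move/(mulfI u0)/addIr/(mulfI u0).
Qed.

(** Equal Gram determinants give equal absolute values, so the two sign quotients have the same
    nonzero denominator. *)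
Lemma triple_gram_inj (R : realType) (u v w u1 v1 w1 : 'rV[R]_3) :
  dot u1 u1 = dot u u -> dot u1 v1 = dot u v -> dot v1 v1 = dot v v ->
  dot u1 w1 = dot u w -> dot v1 w1 = dot v w -> dot w1 w1 = dot w w ->
  triple u v w != 0 ->
  triple u1 v1 w1 / `|triple u1 v1 w1| = triple u v w / `|triple u v w| ->
  triple u1 v1 w1 = triple u v w.
Proof.
move=> uu uv vv uw vw ww uvw0.
have sqr_eq : triple u1 v1 w1 ^+ 2 = triple u v w ^+ 2.
  by rewrite !sqr_triple uu uv vv uw vw ww.
have -> : `|triple u1 v1 w1| = `|triple u v w| by rewrite -!sqrtr_sqr sqr_eq.
by apply: mulIf; rewrite invr_eq0 normr_eq0.
Qed.

Theorem theorem3p6 (R : realType) (t0 t1 : R) (r r1 : R -> 'rV[R]_3)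
  (ht : t0 < t1)
  (r_C3 : class_C3 r t0 t1)
  (r_simple : simple_curve r t0 t1)
  (r_nondeg : nondegenerate_curve r t0 t1)
  (r1_C3 : class_C3 r1 t0 t1)
  (r1_simple : simple_curve r1 t0 t1)
  (r1_nondeg : nondegenerate_curve r1 t0 t1)
  (hphi : forall t : R, t0 < t < t1 -> phi r1 t = enorm (derive1n 1 r t))
  (hpsi12 : forall t : R, t0 < t < t1 ->
    enorm (psi12 r1 t) =
    enorm (- (dot (derive1n 1 r t) (derive1n 2 r t) *: derive1n 1 r t)
           + dot (derive1n 1 r t) (derive1n 1 r t) *: derive1n 2 r t)
    / (2%:R * enorm (derive1n 1 r t) ^+ 3))
  (hpsi13 : forall t : R, t0 < t < t1 -> enorm (psi13 r1 t) = 0)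
  (hpsi23 : forall t : R, t0 < t < t1 ->
    enorm (psi23 r1 t) =
    enorm (- (dot (derive1n 2 r t) (derive1n 3 r t) *: derive1n 2 r t)
           + dot (derive1n 2 r t) (derive1n 2 r t) *: derive1n 3 r t)
    / (3%:R * enorm (derive1n 2 r t) ^+ 3))
  (hepsilon : forall t : R, t0 < t < t1 ->
    epsilon r1 t =
    triple (derive1n 1 r t) (derive1n 2 r t) (derive1n 3 r t) /
    `|triple (derive1n 1 r t) (derive1n 2 r t) (derive1n 3 r t)|) :
  exists T : 'rV[R]_3 -> 'rV[R]_3,
    rigid_motion T /\ forall t : R, t0 < t < t1 -> r1 t = T (r t).
Proof.
have addr_eqI (x y z w : R) : x = z -> x + y = z + w -> y = w.
  by move=> -> /addrI.
have D n t := @class_C3_is_derive R r t0 t1 n t r_C3.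
have D1 n t := @class_C3_is_derive R r1 t0 t1 n t r1_C3.
have two0 : 2%:R != 0 :> R by rewrite pnatr_eq0.
have three0 : 3%:R != 0 :> R by rewrite pnatr_eq0.
have dot11 t : t0 < t < t1 ->
    dot (derive1n 1 r1 t) (derive1n 1 r1 t) =
    dot (derive1n 1 r t) (derive1n 1 r t).
  by move=> /hphi/eq_enorm.
have dot12 t : t0 < t < t1 ->
    dot (derive1n 1 r1 t) (derive1n 2 r1 t) =
    dot (derive1n 1 r t) (derive1n 2 r t).
  move=> tt; have d := D 1%N t isT tt; have d1 := D1 1%N t isT tt.
  have := eq_derive_oo dot11 tt (is_derive_dot d1 d1) (is_derive_dot d d).
  exact: dot_polar_inj.
have dot22 t : t0 < t < t1 ->
    dot (derive1n 2 r1 t) (derive1n 2 r1 t) =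
    dot (derive1n 2 r t) (derive1n 2 r t).
  (* The right-hand side of [hpsi12] is [reject] written out, so computing the norm of [psi12 r1]
     gives both sides the same shape. *)
  move=> tt; have psiE := enorm_psi12 r1_C3 r1_nondeg tt.
  exact: dot_reject_inj (derive1_neq0 r_nondeg tt) two0 (dot11 t tt)
    (dot12 t tt) (etrans (esym psiE) (hpsi12 t tt)).
have dot13 t : t0 < t < t1 ->
    dot (derive1n 1 r1 t) (derive1n 3 r1 t) =
    dot (derive1n 1 r t) (derive1n 3 r t).
  move=> tt; have d := D 1%N t isT tt; have d1 := D1 1%N t isT tt.
  have e := D 2%N t isT tt; have e1 := D1 2%N t isT tt.
  (* Differentiating [r' . r''] gives [r'' . r'' + r' . r'''], whose first term is known from
     [dot22]. *)
  have := eq_derive_oo dot12 tt (is_derive_dot d1 e1) (is_derive_dot d e).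
  exact: addr_eqI (dot22 t tt).
have dot23 t : t0 < t < t1 ->
    dot (derive1n 2 r1 t) (derive1n 3 r1 t) =
    dot (derive1n 2 r t) (derive1n 3 r t).
  move=> tt; have d := D 2%N t isT tt; have d1 := D1 2%N t isT tt.
  have := eq_derive_oo dot22 tt (is_derive_dot d1 d1) (is_derive_dot d d).
  exact: dot_polar_inj.
have dot33 t : t0 < t < t1 ->
    dot (derive1n 3 r1 t) (derive1n 3 r1 t) =
    dot (derive1n 3 r t) (derive1n 3 r t).
  move=> tt; have psiE := enorm_psi23 r1_C3 r1_nondeg tt.
  exact: dot_reject_inj (derive2_neq0 r_nondeg tt) three0 (dot22 t tt)
    (dot23 t tt) (etrans (esym psiE) (hpsi23 t tt)).
apply: (congruent_curves r_C3 r1_C3 r_nondeg dot11 dot12 dot22 dot13 dot23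
  _ ht).
(* The full Gram matrix fixes the triple product up to sign, and [hepsilon] selects the sign. *)
move=> t tt.
exact: triple_gram_inj (dot11 t tt) (dot12 t tt) (dot22 t tt) (dot13 t tt)
  (dot23 t tt) (dot33 t tt) (r_nondeg t tt) (hepsilon t tt).
Qed.
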